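(* Let $\mathcal L$ be a cubic algebra, regarded as an upwards-closed subalgebra of its enveloping algebra $\operatorname{env}(\mathcal L)$, and let $J$ be a g-cover of $\mathcal L$. Then $J$ has the finite intersection property in $\operatorname{env}(\mathcal L)$, and the filter of $\operatorname{env}(\mathcal L)$ generated by $J$ is a g-filter of $\operatorname{env}(\mathcal L)$.
   Context: A cubic algebra is a join-semilattice $\mathcal L$ with top $\mathbf 1$ and a binary operation $\Delta$ such that: if $x\le y$ then $\Delta(y,x)\vee x=y$; if $x\le y\le z$ then $\Delta(z,\Delta(y,x))=\Delta(\Delta(z,y),\Delta(z,x))$; if $x\le y$ then $\Delta(y,\Delta(y,x))=x$; if $x\le y\le z$ then $\Delta(z,x)\le\Delta(z,y)$; and with $xy:=\Delta(\mathbf 1,\Delta(x\vee y,y))\vee y$ one has $(xy)y=x\vee y$ and $x(yz)=y(xz)$. An MR-algebra is a cubic algebra such that whenever $a,b<x$: $\Delta(x,a)\vee b<x$ iff $a\wedge b$ does not exist. The enveloping algebra of $\mathcal L$ is an MR-algebra $\operatorname{env}(\mathcal L)$ with an embedding of $\mathcal L$ whose range generates $\operatorname{env}(\mathcal L)$ and is an upwards-closed subalgebra, such that every cubic homomorphism (map preserving $\vee,\mathbf 1,\Delta$) from $\mathcal L$ into an MR-algebra lifts uniquely to $\operatorname{env}(\mathcal L)$. With $xy$, a cubic algebra is an implication algebra; an implication subalgebra is a subset closed under it. $a\sim b$ iff $\Delta(a\vee b,a)=b$; $\mathcal L/\!\sim$ is an implication algebra with $[a]\le[b]$ iff $\Delta(a\vee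 b,a)\le b$, $[a]\vee[b]=[a\vee\Delta(a\vee b,b)]$, $[a]\to[b]=[\Delta(a\vee b,a)\,b]$. A g-cover of a cubic algebra is an upwards-closed implication subalgebra $J$ such that the restriction to $J$ of the quotient map to $/\!\sim$ is an isomorphism of implication algebras; a g-filter is a g-cover $J$ such that $x\wedge y\in J$ whenever $x,y\in J$ and $x\wedge y$ exists. A subset $J$ of $\operatorname{env}(\mathcal L)$ has the finite intersection property if every finite subset $\{x_1,\dots,x_n\}\subseteq J$ has a meet $x_1\wedge\dots\wedge x_n$ in $\operatorname{env}(\mathcal L)$; the filter it generates is $\{z: z\ge x_1\wedge\cdots\wedge x_n \text{ for some } x_1,\dots,x_n\in J\}$. *)

(* Defs.v *)
From HB Require Import structures.
From mathcomp Require Import all_boot all_order.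
From mathcomp Require Import mathcomp_extra boolp classical_sets functions.
From mathcomp Require Import cardinality.

Set Implicit Arguments.
Unset Strict Implicit.
Unset Printing Implicit Defensive.

Import Order.Theory.
Local Open Scope classical_set_scope.
Local Open Scope order_scope.

(* The cubic implication [x y], as a function of the operation [delta]. *)
Definition cubic_imp_of (d : Order.disp_t) (T : tJoinSemilatticeType d)
    (delta : T -> T -> T) (x y : T) : T :=
  (delta \top (delta (x `|` y) y) `|` y)%O.

(* [delta y x] is meaningful for [x <= y] only: the axioms say nothing about
   its other values, and no definition below depends on them. *)
HB.mixin Record isCubicAlgebra (d : Order.disp_t) T
    of Order.TJoinSemilattice d T := {
  delta : T -> T -> T;
  delta_join : forall x y : T, x <= y -> (delta y x `|` x)%O = y;
  delta_delta : forall x y z : T, x <= y -> y <= z ->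
    delta z (delta y x) = delta (delta z y) (delta z x);
  deltaK : forall x y : T, x <= y -> delta y (delta y x) = x;
  delta_mono : forall x y z : T, x <= y -> y <= z -> delta z x <= delta z y;
  cubic_impK : forall x y : T,
    cubic_imp_of delta (cubic_imp_of delta x y) y = (x `|` y)%O;
  cubic_impCA : forall x y z : T,
    cubic_imp_of delta x (cubic_imp_of delta y z) =
    cubic_imp_of delta y (cubic_imp_of delta x z)
}.

#[short(type="cubicAlgebraType")]
HB.structure Definition CubicAlgebra (d : Order.disp_t) :=
  { T of Order.TJoinSemilattice d T & isCubicAlgebra d T }.

(* [infimums A] is the set of greatest lower bounds of [A], so that
   [infimums A m] reads "the meet of A exists and is m". *)
HB.mixin Record isMRAlgebra (d : Order.disp_t) T of CubicAlgebra d T := {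
  mr_axiom : forall x a b : T, a < x -> b < x ->
    ((delta x a `|` b)%O < x <-> ~ (infimums [set a; b] !=set0))
}.

#[short(type="mrAlgebraType")]
HB.structure Definition MRAlgebra (d : Order.disp_t) :=
  { T of CubicAlgebra d T & isMRAlgebra d T }.

Section CubicAlgebraNotions.
Context {d : Order.disp_t} {L : cubicAlgebraType d}.
Implicit Types (x y a b : L) (J S : set L) (C D : set L).

Definition cubic_imp x y : L := cubic_imp_of delta x y.

Definition up_closed S := forall x y, S x -> x <= y -> S y.

Definition cubic_subalgebra S :=
  [/\ S \top,
      forall x y, S x -> S y -> S (x `|` y)%O &
      forall x y, S x -> S y -> x <= y -> S (delta y x)].

Definition imp_subalgebra S := forall x y, S x -> S y -> S (cubic_imp x y).

Definition cubic_sim a b : Prop := delta (a `|` b)%O a = b.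

(* The quotient by [cubic_sim] is the set of classes [range sim_class]. *)
Definition sim_class a : set L := [set b | cubic_sim a b].

(* The implication of the quotient, computed with all representatives at
   once: [a] -> [b] = [delta (a v b) a => b]. *)
Definition class_imp C D : set L :=
  \bigcup_(a in C) \bigcup_(b in D)
    sim_class (cubic_imp (delta (a `|` b)%O a) b).

Definition g_cover J :=
  [/\ up_closed J, imp_subalgebra J,
      set_bij J (range sim_class) sim_class &
      forall x y, J x -> J y ->
        sim_class (cubic_imp x y) = class_imp (sim_class x) (sim_class y)].

Definition g_filter J :=
  g_cover J /\
  forall x y m, J x -> J y -> infimums [set x; y] m -> J m.

Definition finite_intersection_property S :=
  forall A : set L, finite_set A -> A `<=` S -> infimums A !=set0.

Definition generated_filter S : set L :=
  [set z | exists A : set L,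
     [/\ finite_set A, A `<=` S & exists2 m, infimums A m & m <= z]].

(* Generation as an MR-algebra: meets, when they exist, are among the
   generating operations. *)
Definition mr_generates S :=
  forall T : set L, S `<=` T -> cubic_subalgebra T ->
    (forall x y m, T x -> T y -> infimums [set x; y] m -> T m) ->
    T = setT.

End CubicAlgebraNotions.

Definition cubic_hom (d d' : Order.disp_t) (L : cubicAlgebraType d)
    (M : cubicAlgebraType d') (f : L -> M) : Prop :=
  [/\ f \top = \top,
      forall x y : L, f (x `|` y)%O = (f x `|` f y)%O &
      forall x y : L, x <= y -> f (delta y x) = delta (f y) (f x)].

(* [e : L -> E] exhibits [E] as the enveloping algebra of [L]. *)
Record is_enveloping (d d' : Order.disp_t) (L : cubicAlgebraType d)
    (E : mrAlgebraType d') (e : L -> E) : Prop := IsEnveloping {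
  env_hom : cubic_hom e;
  env_inj : injective e;
  env_generates : mr_generates (range e);
  env_subalgebra : cubic_subalgebra (range e);
  env_up_closed : up_closed (range e);
  env_lift : forall (d'' : Order.disp_t) (M : mrAlgebraType d'') (f : L -> M),
    cubic_hom f ->
    exists! g : E -> M, cubic_hom g /\ (forall x : L, g (e x) = f x)
}.

(* Main.v *)
Require Import Defs.
From mathcomp Require Import all_boot all_order.
From mathcomp Require Import boolp cardinality.
From mathcomp Require Import classical_sets.

(** Two elements [x], [y] of a g-cover [J] have [delta (x v y) x v y = x v y],
    since otherwise this join and its reflection in [x v y] would be distinct
    equivalent elements of [J]; so [x] and [y] meet in the envelope by the MR
    axiom. In an MR-algebra the faces of a cube set the pattern: elements with
    pairwise meets have a common meet (Helly), and two equivalent elements with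
    a meet are equal. The classes that the generated filter reaches form an
    MR-subalgebra containing [L], hence everything, because the class of a meet
    depends only on the classes of its arguments. *)

Set Implicit Arguments.
Unset Strict Implicit.
Unset Printing Implicit Defensive.

Import Order.Theory.
Local Open Scope order_scope.

Local Notation "x ~> y" := (cubic_imp x y) (at level 55, right associativity).

Lemma infimums2P (d : Order.disp_t) (T : porderType d) (x y m : T) :
  infimums [set x; y]%classic m <->
  [/\ m <= x, m <= y & forall k, k <= x -> k <= y -> k <= m].
Proof.
split=> [[lbm ubm]|[mx my mk]].
  split; [by apply: lbm; left | by apply: lbm; right |].
  by move=> k kx ky; apply: ubm => z [->|->].
split=> [z [->|->] //|k lbk].
by apply: mk; apply: lbk; [left | right].
Qed.

(** In an MR-algebra this is the existence of the meet, by [compatible_inf]; in this form it passes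
    to larger elements at once. *)
Definition compatible (d : Order.disp_t) (T : porderType d) (x y : T) : Prop :=
  exists2 k, k <= x & k <= y.

Lemma compatible_sym (d : Order.disp_t) (T : porderType d) (x y : T) :
  compatible x y -> compatible y x.
Proof. by case=> k kx ky; exists k. Qed.

Arguments delta_join {d s} [x y].
Arguments delta_delta {d s} [x y z].
Arguments deltaK {d s} [x y].
Arguments delta_mono {d s} [x y z].
Arguments mr_axiom {d s} [x a b].

(** * Reflections, implication and equivalence in a cubic algebra *)

Section Cubic.
Context {d : Order.disp_t} {L : cubicAlgebraType d}.
Implicit Types a b c k s u v x y z : L.

Lemma delta_refl x : delta x x = x.
Proof.
have E := delta_join (lexx x).
have h : delta x x <= x by rewrite -[leRHS]E leUl.
apply/le_anti; rewrite h /=.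
by have := delta_mono h (lexx x); rewrite deltaK.
Qed.

Lemma delta_le x y : x <= y -> delta y x <= y.
Proof. by move=> xy; rewrite -[leRHS](delta_join xy) leUl. Qed.

Lemma delta_le_swap x y s :
  x <= s -> y <= s -> delta s x <= y -> x <= delta s y.
Proof. by move=> xs ys h; have := delta_mono h ys; rewrite deltaK. Qed.

Lemma le_imp x y : y <= x ~> y.
Proof. exact: leUr. Qed.

Lemma imp_le x y : x <= y -> x ~> y = \top.
Proof.
move=> xy; rewrite /cubic_imp /cubic_imp_of (join_r xy) delta_refl.
by rewrite delta_join // lex1.
Qed.

Lemma imp1 y : \top ~> y = y.
Proof.
by rewrite /cubic_imp /cubic_imp_of join1x deltaK ?lex1// joinxx.
Qed.

Lemma impK x y : (x ~> y) ~> y = x `|` y.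
Proof. exact: cubic_impK. Qed.

Lemma impCA x y z : x ~> y ~> z = y ~> x ~> z.
Proof. exact: cubic_impCA. Qed.

Lemma imp_leP x y : x ~> y = \top -> x <= y.
Proof. by move=> h; have := impK x y; rewrite h imp1 => ->; rewrite leUl. Qed.

Lemma imp_swap x y z : x <= y ~> z -> y <= x ~> z.
Proof. by move=> /imp_le h; apply: imp_leP; rewrite impCA. Qed.

Lemma impr_mono x y z : y <= z -> x ~> y <= x ~> z.
Proof.
(* Written this way, [x ~> z] becomes [(z ~> y) ~> x ~> y] by exchange. *)
move=> yz; have -> : z = (z ~> y) ~> y by rewrite impK join_l.
by rewrite impCA le_imp.
Qed.

Lemma impl_anti x y z : x <= y -> y ~> z <= x ~> z.
Proof. by move=> xy; apply: imp_swap; rewrite impK (le_trans xy) ?leUl. Qed.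

Lemma sim_delta a s : a <= s -> cubic_sim a (delta s a).
Proof. by move=> as_; rewrite /cubic_sim joinC delta_join. Qed.

Lemma sim_refl a : cubic_sim a a.
Proof. by rewrite /cubic_sim joinxx delta_refl. Qed.

Lemma sim_sym a b : cubic_sim a b -> cubic_sim b a.
Proof. by rewrite /cubic_sim joinC => h; rewrite -{2}h deltaK // leUr. Qed.

Lemma sim_top a : cubic_sim \top a -> a = \top.
Proof. by rewrite /cubic_sim join1x delta_refl. Qed.

Lemma sim_down a b c : a <= b -> cubic_sim b c ->
  exists2 a', cubic_sim a a' & a' <= c.
Proof.
move=> ab bc; exists (delta (b `|` c) a); first exact/sim_delta/lexUl.
by rewrite -[leRHS]bc delta_mono // leUl.
Qed.

End Cubic.

(** * The MR axiom as a criterion for meets *)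

Section MR.
Context {d : Order.disp_t} {E : mrAlgebraType d}.
Implicit Types a b c g h k m n p q r s t u v w x y z : E.

(** This makes [x ~> y] a complement. It rests on the MR axiom: [w <= s] have a meet, so
    [delta \top w] and [s] cannot join below [\top]. *)
Lemma join_imp x y : x `|` (x ~> y) = \top.
Proof.
have -> : x `|` (x ~> y) = delta \top (delta (x `|` y) y) `|` (x `|` y).
  by rewrite /cubic_imp /cubic_imp_of joinCA.
set s := x `|` y; set w := delta s y.
have ws : w <= s by rewrite delta_le // leUr.
have [->|s1] := eqVneq s \top; first by rewrite joinx1.
have sl : s < \top by rewrite lt_neqAle s1 lex1.
have wl : w < \top := le_lt_trans ws sl.
apply: contrapT => /eqP ne.
have /(mr_axiom wl sl) : delta \top w `|` s < \top by rewrite lt_neqAle ne lex1.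
by apply; exists w; apply/infimums2P.
Qed.

Lemma imp_absorb x z : x <= x ~> z -> x <= z.
Proof. by move=> h; apply: imp_leP; rewrite -(join_imp x z) join_r. Qed.

(** De Morgan above the lower bound [m]: [x ~> y ~> m] is the join of the complements of [x] and [y]
    over [m], and its own complement is the meet. *)
Lemma compatible_inf x y :
  compatible x y -> exists m, infimums [set x; y]%classic m.
Proof.
case=> m mx my; exists ((x ~> y ~> m) ~> m); apply/infimums2P; split.
- rewrite -[leRHS](join_l mx) -impK; apply: impl_anti.
  exact/impr_mono/le_imp.
- rewrite -[leRHS](join_l my) -impK impCA; apply: impl_anti.
  exact/impr_mono/le_imp.
move=> k kx ky; apply: imp_swap.
apply: le_trans (impl_anti _ kx) _; rewrite impCA.
apply: le_trans (impl_anti _ ky) _.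
(* Contraction: [k ~> k ~> m] lies below [k ~> m]. *)
by apply: imp_leP; rewrite impK join_imp.
Qed.

(** The MR axiom in positive form, with the boundary cases [a = s] and [b = s] included; the next
    lemma is the converse. *)
Lemma compatible_delta_join s a b : a <= s -> b <= s -> compatible a b ->
  delta s a `|` b = s.
Proof.
move=> as_ bs /compatible_inf ab.
have [->|an] := eqVneq a s; first by rewrite delta_refl join_l.
have [->|bn] := eqVneq b s; first by rewrite join_r // delta_le.
have al : a < s by rewrite lt_neqAle an.
have bl : b < s by rewrite lt_neqAle bn.
apply: contrapT => /eqP ne.
have /(mr_axiom al bl) // : delta s a `|` b < s.
by rewrite lt_neqAle ne leUx delta_le.
Qed.

Lemma delta_join_compatible s a b : a <= s -> b <= s ->
  delta s a `|` b = s -> compatible a b.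
Proof.
move=> as_ bs dab.
have [->|an] := eqVneq a s; first by exists b.
have [->|bn] := eqVneq b s; first by exists a.
have al : a < s by rewrite lt_neqAle an.
have bl : b < s by rewrite lt_neqAle bn.
apply: contrapT => ncomp.
suff : delta s a `|` b < s by rewrite dab ltxx.
apply/(mr_axiom al bl) => -[m /infimums2P[ma mb _]].
by apply: ncomp; exists m.
Qed.

(** The reflection of [x] in the join is [y], so the MR criterion makes the join equal to [y], which
    reflects to itself. *)
Lemma sim_compatible_eq x y : cubic_sim x y -> compatible x y -> x = y.
Proof.
move=> xy c.
have := compatible_delta_join (leUl x y) (leUr y x) c.
rewrite xy joinxx => ys; have := sim_sym xy.
by rewrite /cubic_sim joinC -ys delta_refl.
Qed.

(** * Relative complements and composed reflections *)

(** The bound [h <= s ~> z] thus records that [h] and [s] overlap only inside [z]. *)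
Lemma le_imp_lb k s h z : h <= s ~> z -> k <= s -> k <= h -> k <= z.
Proof.
move=> hsz ks kh; apply: imp_absorb; apply: le_trans ks _.
apply: imp_swap; exact: le_trans kh hsz.
Qed.

Lemma relative_complement z s g : z <= s -> s <= g -> exists h,
  [/\ z <= h, h <= g, s `|` h = g & h <= s ~> z].
Proof.
(* Complementing [g ~> s] over [z] gives [g] minus [s] in the interval above [z]. *)
move=> zs sg; exists ((g ~> s) ~> z).
have hg : (g ~> s) ~> z <= g.
  by rewrite -[leRHS](join_l sg) -impK impr_mono.
split=> //; first exact: le_imp.
- apply/le_anti; rewrite leUx sg hg /=.
  set v := s `|` _.
  have vz : v ~> z <= g ~> v.
    apply: le_trans (impr_mono _ (leUl _ _)).
    apply: le_trans (impl_anti z (leUr _ _)) _.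
    by rewrite impK leUx lexx (le_trans zs (le_imp _ _)).
  apply: imp_leP; apply/le_anti; rewrite lex1 -(join_imp v z).
  by rewrite leUx vz le_imp.
apply: impl_anti; exact: le_imp.
Qed.

(** Distributivity: the complement of [r] over [m] lies below [p] and [q], hence below [m], which
    forces [r = \top]. *)
Lemma inf_join_le m p q s w : infimums [set p; q]%classic m ->
  m <= w -> s <= p `|` w -> s <= q `|` w -> s <= w.
Proof.
move=> /infimums2P[mp mq infm] mw sp sq.
set r := s ~> w.
have mr : m <= r := le_trans mw (le_imp _ _).
have aux t : m <= t -> s <= t `|` w -> r ~> m <= t.
  move=> mt st; rewrite -[leRHS](join_l mt) -impK; apply: impl_anti.
  apply: le_trans (impr_mono _ mw) _.
  by apply: imp_swap; rewrite impK.
have rm : r ~> m <= m by rewrite infm ?aux.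
apply: imp_leP; rewrite -/r -(join_l mr) -impK; exact: imp_le.
Qed.

(* A failure would produce a proper complement of [u `|` delta _ (delta s z)],
   to which the MR axiom applies first inside [s `|` u] and then inside [s]. *)
Lemma delta_delta_le z s u : z <= s -> z <= u ->
  delta (s `|` u) (delta s z) <= u.
Proof.
move=> zs zu; set q := s `|` u; set z' := delta s z.
have sq : s <= q := leUl _ _.
have uq : u <= q := leUr _ _.
have z's : z' <= s := delta_le zs.
have z'q : z' <= q := le_trans z's sq.
set r := u `|` delta q z'.
have rq : r <= q by rewrite leUx uq delta_le.
have [l [ul lq rl infl]] := relative_complement (leUl u (delta q z')) rq.
have lz' : compatible z' l.
  apply: (delta_join_compatible z'q lq); apply/le_anti.
  rewrite leUx lq delta_le //= -{1}rl leUx leUr andbT leUx leUl andbT.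
  by rewrite (le_trans ul) ?leUr.
have zl := le_trans zu ul.
have [k /infimums2P[kl ks infk]] : exists k, infimums [set l; s]%classic k.
  by apply: compatible_inf; exists z.
have kz' : compatible k z'.
  case: lz' => n nz' nl; exists n => //; apply: infk => //.
  exact: le_trans nz' z's.
have z'k : z' <= delta s k by apply: delta_mono => //; exact: infk.
have := compatible_delta_join ks z's kz'; rewrite join_l // => dks.
(* Thus [l] lies above [s], hence above all of [q]; as a complement of [r] over [u] it forces
   [r <= u]. *)
have ksE : k = s by rewrite -(deltaK ks) dks delta_refl.
have ql : q <= l by rewrite leUx ul -ksE kl.
apply: (le_trans (leUr _ u)); apply: (le_imp_lb infl) => //; exact: le_trans rq ql.
Qed.

(** * The equivalence in an MR-algebra and the order of its quotient *)

Lemma sim_up a b c : a <= b -> cubic_sim a c ->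
  exists2 b', cubic_sim b b' & c <= b'.
Proof.
move=> ab ac; exists (delta ((a `|` c) `|` b) b).
  exact/sim_delta/leUr.
apply: delta_le_swap; [exact/lexUl/leUr | exact: leUr | ].
by rewrite -{2}ac delta_delta_le // leUl.
Qed.

(** Reflecting in [s] and then in [g] flips only the directions of [g] outside [s], which are those
    of [h]. The hypotheses are symmetric in [s] and [h], so one inequality is enough. *)
Lemma delta_complement z s h g : z <= s -> z <= h -> s `|` h = g ->
  h <= s ~> z -> delta g (delta s z) = delta h z.
Proof.
move=> zs zh shg infz.
have sg : s <= g by rewrite -shg leUl.
have hg : h <= g by rewrite -shg leUr.
have upper s1 h1 : z <= s1 -> z <= h1 -> s1 `|` h1 = g ->
    h1 <= s1 ~> z -> delta g (delta s1 z) <= delta h1 z.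
  move=> zs1 zh1 shg1 infz1.
  have sg1 : s1 <= g by rewrite -shg1 leUl.
  have hg1 : h1 <= g by rewrite -shg1 leUr.
  set y := delta g (delta s1 z).
  have yh : y <= h1 by rewrite /y -shg1 delta_delta_le.
  have yg : y <= delta g s1 by rewrite delta_mono // delta_le.
  apply: delta_le_swap => //; apply: (le_imp_lb infz1); last exact: delta_le.
  have hs : delta g s1 `|` h1 = g.
    by apply: compatible_delta_join => //; exists z.
  have := delta_delta_le yh yg; rewrite joinC hs => h2.
  rewrite -[leRHS](deltaK sg1).
  apply: delta_le_swap => //; last exact: delta_le.
  exact: le_trans (delta_le yh) hg1.
apply/le_anti; rewrite upper //=; apply: delta_le_swap.
- exact: le_trans (delta_le zh) hg.
- exact: le_trans (delta_le zs) sg.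
by apply: upper => //; [rewrite joinC | exact: imp_swap].
Qed.

(* With complements taken above [z], [delta s] followed by [delta t] is
   [delta] at the symmetric difference of [s] and [t]. *)
Lemma sim_euclid z x y : cubic_sim z x -> cubic_sim z y -> cubic_sim x y.
Proof.
rewrite {1 2}/cubic_sim; set s := z `|` x; set t := z `|` y => sx ty.
have zs : z <= s := leUl _ _.
have zt : z <= t := leUl _ _.
set g := s `|` t.
have sg : s <= g := leUl _ _.
have tg : t <= g := leUr _ _.
have [t1 [zt1 t1g st1 t1s]] := relative_complement zs sg.
have [s1 [zs1 s1g ts1 s1t]] := relative_complement zt tg.
(* [delta g] carries [x], [y], [p] to [delta t1 z], [delta s1 z], [p0], so [delta p x = y] reduces
   to [delta_complement] for [t1] and [s1], which are disjoint over [z]. *)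
set p0 := t1 `|` s1; set p := delta g p0.
have p0g : p0 <= g by rewrite leUx t1g.
have pg : p <= g := delta_le p0g.
have t1s1 : s1 <= t1 ~> z.
  apply: imp_swap; apply: imp_absorb; apply: (le_trans t1g).
  rewrite leUx; apply/andP; split.
    apply: (le_trans (imp_swap t1s)); exact/impr_mono/le_imp.
  exact: le_trans (imp_swap s1t) (le_imp _ _).
have xg : x <= g by rewrite -sx (le_trans (delta_le zs)).
have yg : y <= g by rewrite -ty (le_trans (delta_le zt)).
have dgx : delta g x = delta t1 z by rewrite -sx (delta_complement zs zt1 st1 t1s).
have dgy : delta g y = delta s1 z by rewrite -ty (delta_complement zt zs1 ts1 s1t).
have xp : x <= p.
  apply: delta_le_swap => //.
  by rewrite dgx (le_trans (delta_le zt1)) ?leUl.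
suff <- : delta p x = y by exact: sim_delta.
rewrite -[LHS](deltaK (le_trans (delta_le xp) pg)) -[RHS](deltaK yg).
have dgp : delta g p = p0 by exact: deltaK.
congr (delta g _); rewrite delta_delta // dgp dgx dgy.
exact: (delta_complement zt1 zs1 (erefl p0) t1s1).
Qed.

Lemma sim_trans x y z : cubic_sim x y -> cubic_sim y z -> cubic_sim x z.
Proof. by move=> /sim_sym; exact: sim_euclid. Qed.

Lemma sim_classP x y : cubic_sim x y <-> sim_class x = sim_class y.
Proof.
split=> [xy|xy].
  apply/seteqP; split=> z /=; first exact: sim_euclid.
  exact: sim_trans.
by have : sim_class y y by [exact: sim_refl]; rewrite -xy.
Qed.

(* The order of the quotient, on representatives. *)
Definition sim_le x y := exists2 y', cubic_sim y y' & x <= y'.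

Lemma sim_le_trans y x z : sim_le x y -> sim_le y z -> sim_le x z.
Proof.
move=> [y' yy' xy'] [z' zz' yz'].
have [z'' zz'' yz''] := sim_up yz' yy'.
by exists z''; [exact: sim_trans zz' zz'' | exact: le_trans xy' yz''].
Qed.

Lemma sim_sim_le x y : cubic_sim x y -> sim_le x y.
Proof. by move=> /sim_sym xy; exists x. Qed.

(** Lifting gives [x <= y' <= x''] with [x''] equivalent to [x]; comparable equivalent elements are
    equal, so the chain collapses. *)
Lemma sim_le_anti x y : sim_le x y -> sim_le y x -> cubic_sim x y.
Proof.
move=> [y' yy' xy'] [x' xx' yx'].
have [x'' x'x'' yx''] := sim_up yx' yy'.
have xx'' : cubic_sim x x'' := sim_trans xx' x'x''.
have xE : x = x''.
  by apply: sim_compatible_eq xx'' _; exists x => //; exact: le_trans yx''.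
suff -> : x = y' by exact: sim_sym.
by apply/le_anti; rewrite xy' xE.
Qed.

(** * Implication and meets of classes *)

(** The two classes join to the top of the quotient; by [sim_top] the class of [\top] is a
    singleton. *)
Definition sim_cover x y := forall u, sim_le x u -> sim_le y u -> u = \top.

Lemma sim_cover_sim x x' y y' : sim_le x x' -> sim_le y y' ->
  sim_cover x y -> sim_cover x' y'.
Proof.
by move=> xx' yy' h u x'u y'u; apply: h; [exact: sim_le_trans xx' x'u |
  exact: sim_le_trans yy' y'u].
Qed.

(* A description of the implication of classes in terms of [sim_le] only, so
   that independence of the representatives is automatic. *)
Definition is_sim_imp x y c :=
  [/\ sim_le y c, sim_cover x c &
     forall u, sim_le y u -> sim_cover x u -> sim_le c u].

Lemma compatible_sim_imp x y : compatible x y -> is_sim_imp x y (x ~> y).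
Proof.
move=> [k kx ky]; split.
- by exists (x ~> y); [exact: sim_refl | exact: le_imp].
- move=> u [u1 uu1 xu1] [u2 uu2 iu2].
  (* Two representatives of one class above the same [k] coincide. *)
  have u12 : u1 = u2.
    apply: sim_compatible_eq (sim_euclid uu1 uu2) _; exists k.
      exact: le_trans xu1.
    by rewrite (le_trans ky) // (le_trans (le_imp x y)).
  apply: sim_top; apply: sim_sym; suff <- : u1 = \top by [].
  by apply/le_anti; rewrite lex1 -(join_imp x y) leUx xu1 u12.
move=> u [u' uu' yu'] xu; exists u' => //.
have xu1 : x `|` u' = \top.
  apply: xu; first by exists (x `|` u'); [exact: sim_refl | exact: leUl].
  apply: sim_le_trans (sim_sim_le uu') _.
  by exists (x `|` u'); [exact: sim_refl | exact: leUr].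
apply: le_trans (impr_mono x yu') _.
by apply: imp_leP; rewrite impK.
Qed.

Lemma is_sim_imp_unique x y c x' y' c' : cubic_sim x x' -> cubic_sim y y' ->
  is_sim_imp x y c -> is_sim_imp x' y' c' -> cubic_sim c c'.
Proof.
have half x1 y1 c1 x2 y2 c2 : cubic_sim x1 x2 -> cubic_sim y1 y2 ->
    is_sim_imp x1 y1 c1 -> is_sim_imp x2 y2 c2 -> sim_le c1 c2.
  move=> /sim_sym/sim_sim_le xx /sim_sim_le yy [_ _ least] [yc cov _].
  apply: least; first exact: sim_le_trans yy yc.
  exact: sim_cover_sim xx (sim_sim_le (sim_refl c2)) cov.
move=> xx yy h h'; apply: sim_le_anti; first exact: half xx yy h h'.
exact: half (sim_sym xx) (sim_sym yy) h' h.
Qed.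

Lemma compatible_delta a b : compatible (delta (a `|` b) a) b.
Proof.
apply: (@delta_join_compatible (a `|` b)); rewrite ?leUr//.
  by rewrite delta_le // leUl.
by rewrite deltaK // leUl.
Qed.

(** Each implication in the union is that of a compatible pair, by [compatible_delta], so
    [is_sim_imp] fixes its class. *)
Lemma class_imp_compatible x y : compatible x y ->
  sim_class (x ~> y) = class_imp (sim_class x) (sim_class y).
Proof.
move=> cxy.
have key a b : cubic_sim x a -> cubic_sim y b ->
    cubic_sim (x ~> y) (delta (a `|` b) a ~> b).
  move=> xa yb.
  have xa' : cubic_sim x (delta (a `|` b) a).
    exact: sim_trans xa (sim_delta (leUl a b)).
  exact: is_sim_imp_unique xa' yb (compatible_sim_imp cxy)
    (compatible_sim_imp (compatible_delta a b)).
apply/seteqP; split=> z /=.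
  move=> xyz; exists x; first exact: sim_refl.
  exists y; first exact: sim_refl.
  exact: sim_euclid (key _ _ (sim_refl x) (sim_refl y)) xyz.
case=> a xa [b yb] /=; exact/sim_trans/key.
Qed.

(** The directions in which [y] and [y'] differ form the complement [h] of [y] in [g]. Compatibility
    of [x] with [y'] puts [h] below [x], so reflecting [k] in [h] follows [y] to [y'] without
    leaving [x]. *)
Lemma sim_lb k x y y' : k <= x -> k <= y -> cubic_sim y y' ->
  compatible x y' -> exists k', [/\ cubic_sim k k', k' <= x & k' <= y'].
Proof.
move=> kx ky yy' cxy'; set g := y `|` y'; set q := x `|` y.
have yg : y <= g := leUl _ _.
have dq : delta (g `|` q) y' <= q.
  by rewrite -{1}yy' delta_delta_le // leUr.
have gq : g <= q.
  apply: (le_trans (leUl g q)); apply: le_trans (_ : delta (g `|` q) y' `|` x <= q).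
    rewrite compatible_delta_join //; [exact/lexUl/leUr | | exact: compatible_sym].
    exact/lexUr/leUl.
  by rewrite leUx dq leUl.
have kg := le_trans ky yg.
have [h [kh hg yhg hyk]] := relative_complement ky yg.
have hx : h <= x.
  apply: (@le_imp_lb h (y ~> x) h); rewrite ?lexx//.
    by rewrite impK joinC (le_trans hg gq).
  exact: le_trans hyk (impr_mono y kx).
exists (delta h k); split; first exact: sim_delta.
  exact: le_trans (delta_le kh) hx.
rewrite -(delta_complement ky kh yhg hyk) -[leRHS]yy'.
by rewrite delta_mono // delta_le.
Qed.

Lemma sim_inf x y m x' y' m' : infimums [set x; y]%classic m ->
  infimums [set x'; y']%classic m' -> cubic_sim x x' -> cubic_sim y y' ->
  cubic_sim m m'.
Proof.
have half x1 y1 m1 x2 y2 m2 : infimums [set x1; y1]%classic m1 ->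
    infimums [set x2; y2]%classic m2 -> cubic_sim x1 x2 -> cubic_sim y1 y2 ->
    sim_le m1 m2.
  move=> /infimums2P[mx my _] /infimums2P[mx' my' inf2] xx yy.
  (* First [x1] is replaced by [x2], dragging [y1] to [y3]; then [sim_lb] replaces [y3] by [y2] with
     [x2] fixed. *)
  have [k mk kx] := sim_down mx xx.
  have [y3 yy3 ky] := sim_up my mk.
  have [|k' [kk' k'x k'y]] := sim_lb kx ky (sim_euclid yy3 yy).
    by exists m2.
  apply: (@sim_le_trans k'); first exact/sim_sim_le/(sim_trans mk kk').
  by exists m2; [exact: sim_refl | exact: inf2].
move=> h h' xx yy; apply: sim_le_anti; first exact: half h h' xx yy.
exact: half h' h (sim_sym xx) (sim_sym yy).
Qed.

(** * The Helly property and finite intersections *)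

(** Cut down to [s], [a] and [b] still meet in [n], and their reflections in [s] each join with [c]
    to [s]. Reflection is an order automorphism below [s], so it keeps the meet, and [inf_join_le]
    yields the same join for [delta s n]. *)
Lemma helly3 a b c n : infimums [set a; b]%classic n ->
  compatible a c -> compatible b c -> compatible n c.
Proof.
move=> infn ac bc; have /infimums2P[na nb nn] := infn.
set s := n `|` c.
have ns : n <= s := leUl _ _.
have cs : c <= s := leUr _ _.
have reflect x : n <= x -> compatible x c -> exists x',
    [/\ n <= x', x' <= x, x' <= s & s <= delta s x' `|` c].
  move=> nx [k kx kc].
  have [x' /infimums2P[x'x x's infx']] : exists x',
      infimums [set x; s]%classic x' by apply: compatible_inf; exists n.
  exists x'; split=> //; first exact: infx'.
  rewrite compatible_delta_join //; exists k => //; apply: infx' => //.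
  exact: le_trans kc cs.
have [a' [na' a'a a's sa']] := reflect a na ac.
have [b' [nb' b'b b's sb']] := reflect b nb bc.
have infd : infimums [set delta s a'; delta s b']%classic (delta s n).
  apply/infimums2P; split; [exact: delta_mono | exact: delta_mono |].
  move=> k ka kb; have ks := le_trans ka (delta_le a's).
  have swap x : x <= s -> k <= delta s x -> delta s k <= x.
    by move=> xs /delta_mono h; rewrite -[leRHS](deltaK xs) h // delta_le.
  apply: delta_le_swap => //; apply: nn.
    exact: le_trans (swap _ a's ka) a'a.
  exact: le_trans (swap _ b's kb) b'b.
apply: (delta_join_compatible ns cs); apply/le_anti.
rewrite leUx delta_le // cs /=.
have up x : x `|` c <= x `|` (delta s n `|` c) by rewrite leU2 ?leUr.
apply: (inf_join_le infd (leUl _ _)).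
  exact: le_trans sa' (up _).
exact: le_trans sb' (up _).
Qed.

(** The induction also carries compatibility of the meet with all of [S], which [helly3]
    preserves. *)
Lemma pairwise_compatible_seq (S : set E) (l : seq E) :
  (forall x y, S x -> S y -> compatible x y) ->
  (forall x, x \in l -> S x) ->
  exists2 m, infimums [set` l]%classic m & forall y, S y -> compatible m y.
Proof.
move=> pS; elim: l => [|x l IH] lS.
  exists \top; last by move=> y _; exists y => //; exact: lex1.
  by split=> [z //|k _]; exact: lex1.
have [|m [lbm ubm] cm] := IH.
  by move=> z zl; apply: lS; rewrite inE zl orbT.
have Sx : S x by apply: lS; rewrite inE eqxx.
have [n infn] := compatible_inf (cm x Sx).
have /infimums2P[nm nx nn] := infn.
exists n; last first.
  by move=> y Sy; apply: (helly3 infn); [exact: cm | exact: pS].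
split=> [z|k lbk] /=.
  rewrite inE => /orP[/eqP -> //|zl]; exact: le_trans nm (lbm _ zl).
apply: nn; last by apply: lbk; rewrite /= inE eqxx.
by apply: ubm => z zl; apply: lbk; rewrite /= inE zl orbT.
Qed.

Lemma pairwise_compatible_fip (S : set E) :
  (forall x y, S x -> S y -> compatible x y) -> finite_intersection_property S.
Proof.
move=> pS A /finite_seqP[l ->] lS.
by have [m infm _] := pairwise_compatible_seq pS lS; exists m.
Qed.

(** * Generated filters *)

Lemma generated_filter_sub (S : set E) x : S x -> generated_filter S x.
Proof.
move=> Sx; exists [set x]%classic; split=> [| z -> //|]; first exact: finite_set1.
by exists x => //; rewrite infimums1.
Qed.

Lemma generated_filter_up (S : set E) : up_closed (generated_filter S).
Proof.
move=> x y [A [fA AS [m infm mx]]] xy; exists A; split=> //.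
by exists m => //; exact: le_trans xy.
Qed.

Lemma generated_filter_top (S : set E) : generated_filter S \top.
Proof.
exists set0; split=> //; exists \top => //.
by split=> [z //|k _]; exact: lex1.
Qed.

Lemma generated_filter_lb (S : set E) x y :
  finite_intersection_property S -> generated_filter S x ->
  generated_filter S y -> exists k, [/\ generated_filter S k, k <= x & k <= y].
Proof.
move=> fip [A [fA AS [a infa ax]]] [B [fB BS [b infb bx]]].
have fAB : finite_set (A `|` B)%classic by rewrite finite_setU.
have ABS : (A `|` B `<=` S)%classic by move=> z [/AS|/BS].
have [k infk] := fip _ fAB ABS; have [lbk _] := infk.
exists k; split.
- by exists (A `|` B)%classic; split=> //; exists k.
- by apply: le_trans ax; apply: infa.2 => z Az; apply: lbk; left.
- by apply: le_trans bx; apply: infb.2 => z Bz; apply: lbk; right.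
Qed.

(** * Down-directed up-closed sets as g-filters *)

Section DirectedFilter.
Variable F : set E.
Hypothesis F_up : up_closed F.
Hypothesis F_lb : forall x y, F x -> F y ->
  exists k, [/\ F k, k <= x & k <= y].

Lemma directed_compatible x y : F x -> F y -> compatible x y.
Proof. by move=> Fx Fy; have [k [_ kx ky]] := F_lb Fx Fy; exists k. Qed.

Lemma directed_inf x y m : F x -> F y -> infimums [set x; y]%classic m -> F m.
Proof.
move=> Fx Fy /infimums2P[_ _ infm]; have [k [Fk kx ky]] := F_lb Fx Fy.
exact: F_up Fk (infm _ kx ky).
Qed.

(** The union of the classes that [F] reaches; [F] maps onto the quotient when this is
    everything. *)
Definition sim_saturation := [set z | exists2 z', F z' & cubic_sim z' z]%classic.

Lemma sim_saturation_subalgebra : F \top -> cubic_subalgebra sim_saturation.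
Proof.
move=> F1; split.
- by exists \top => //; exact: sim_refl.
- move=> x y [x' Fx' /sim_sym xx'] _.
  have [u xu xu'] := sim_up (leUl x y) xx'.
  by exists u; [exact: F_up xu' | exact: sim_sym].
- move=> x y [x' Fx' xx'] _ xy; exists x' => //.
  exact: sim_trans xx' (sim_delta xy).
Qed.

Lemma sim_saturation_inf x y m : sim_saturation x -> sim_saturation y ->
  infimums [set x; y]%classic m -> sim_saturation m.
Proof.
move=> [x' Fx' xx'] [y' Fy' yy'] infm.
have [m' infm'] := compatible_inf (directed_compatible Fx' Fy').
exists m'; first exact: directed_inf infm'.
exact: sim_inf infm' infm xx' yy'.
Qed.

Lemma directed_g_filter : (forall z, sim_saturation z) -> g_filter F.
Proof.
move=> satF; split; last by move=> x y m; exact: directed_inf.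
split=> //.
- by move=> x y _ Fy; exact: F_up Fy (le_imp x y).
- split.
  + by move=> x _; exists x.
  + move=> x y; rewrite !inE => Fx Fy /sim_classP xy.
    exact: sim_compatible_eq xy (directed_compatible Fx Fy).
  + move=> _ [z _ <-]; have [z' Fz' z'z] := satF z.
    by exists z' => //; exact/sim_classP.
- by move=> x y Fx Fy; exact/class_imp_compatible/directed_compatible.
Qed.

End DirectedFilter.
End MR.

(** * From the cubic algebra to its envelope *)

Section Embedding.
Context {d d' : Order.disp_t} {L : cubicAlgebraType d} {E : mrAlgebraType d'}.
Variable e : L -> E.
Hypothesis e_hom : cubic_hom e.
Hypothesis e_inj : injective e.

Lemma cubic_hom_sim (a b : L) : cubic_sim a b <-> cubic_sim (e a) (e b).
Proof.
have [_ eU eD] := e_hom.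
rewrite /cubic_sim -eU -eD ?leUl//.
by split=> [->|/e_inj].
Qed.

(** Transitivity in [L] is pulled back from [E] along the embedding. *)
Lemma cubic_hom_sim_class (a b : L) : cubic_sim a b -> sim_class a = sim_class b.
Proof.
move=> /cubic_hom_sim ab; apply/seteqP; split=> z /= /cubic_hom_sim az.
  exact/cubic_hom_sim/(sim_euclid ab).
exact/cubic_hom_sim/(sim_trans ab).
Qed.

Lemma g_cover_compatible (J : set L) x y : g_cover J -> J x -> J y ->
  compatible (e x) (e y).
Proof.
move=> [Jup _ [_ Jinj _] _] Jx Jy; have [_ eU eD] := e_hom.
set s := x `|` y; set t := delta s x `|` y.
have xs : x <= s := leUl _ _.
have ys : y <= s := leUr _ _.
have ts : t <= s by rewrite leUx delta_le.
have Jt : J t by apply: Jup Jy _; exact: leUr.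
have xt : x <= delta s t by apply: delta_le_swap => //; exact: leUl.
have tE : t = delta s t.
  apply: Jinj; rewrite ?inE//; first exact: Jup Jx xt.
  exact/cubic_hom_sim_class/sim_delta.
(* An element that its reflection in [s] fixes joins with itself to [s]. *)
have est : t = s by rewrite -(delta_join ts) -tE joinxx.
apply: (@delta_join_compatible _ _ (e s)).
- by rewrite eU leUl.
- by rewrite eU leUr.
- by rewrite -eD // -eU -/t est.
Qed.

End Embedding.

Theorem theorem6p3 (d d' : Order.disp_t) (L : cubicAlgebraType d)
    (E : mrAlgebraType d') (e : L -> E) (he : is_enveloping e)
    (J : set L) (hJ : g_cover J) :
  finite_intersection_property (image J e) /\
  g_filter (generated_filter (image J e)).
Proof.
have e_hom := env_hom he; have e_inj := env_inj he.
have fip : finite_intersection_property (image J e).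
  apply: pairwise_compatible_fip => _ _ [x Jx <-] [y Jy <-].
  exact: (g_cover_compatible e_hom e_inj hJ).
split=> //.
have lb x y := @generated_filter_lb _ _ _ x y fip.
have up := @generated_filter_up _ _ (image J e).
apply: (directed_g_filter up lb).
suff satT : sim_saturation (generated_filter (image J e)) = setT.
  by move=> z; rewrite satT.
apply: (env_generates he).
(* [J] reaches every class of [L], so [e x] is equivalent to some [e j]. *)
- move=> _ [x _ <-]; have [_ _ [_ _ Jsurj] _] := hJ.
  have [j Jj jx] : image J sim_class (sim_class x) by apply: Jsurj; exists x.
  exists (e j); first by apply: generated_filter_sub; exists j.
  apply/(cubic_hom_sim e_hom e_inj).
  by have : sim_class x x by [exact: sim_refl]; rewrite -jx.
- exact/sim_saturation_subalgebra/generated_filter_top.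
- by move=> x y m; exact: sim_saturation_inf.
Qed.
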